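(* Let $L$ be a non-abelian nilpotent Lie ring additively isomorphic to $\mathbb{Z}^h$, of nilpotency class $c$. Then (1) $\alpha_L^{\leq}\le h-\frac12$ if $c=2$, and $\alpha_L^{\leq}\le h-\frac{1}{c-1}$ if $c>2$; (2) $\alpha_L^{\lhd}\le h-1$.
   Context: For a Lie ring $L$ additively isomorphic to $\mathbb{Z}^h$, $a_n^{\leq}(L)$ (resp. $a_n^{\lhd}(L)$) is the number of Lie subrings (resp. ideals) of additive index $n$, and $\alpha_L^*$ is the abscissa of convergence of $\zeta_L^*(s)=\sum_n a_n^*(L)n^{-s}$, $*\in\{\leq,\lhd\}$. *)

(* Defs.v *)
From HB Require Import structures.
From mathcomp Require Import all_boot all_order all_algebra.
From mathcomp Require Import all_classical all_reals all_analysis.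
Set Implicit Arguments. Unset Strict Implicit. Unset Printing Implicit Defensive.
Import Order.TTheory GRing.Theory Num.Theory.
Local Open Scope classical_set_scope.
Local Open Scope ring_scope.

Definition lat (h : nat) := 'rV[int]_h.

Definition is_lie_bracket (h : nat) (br : lat h -> lat h -> lat h) : Prop :=
  [/\ (forall x y z, br (x + y) z = br x z + br y z),
      (forall x y z, br x (y + z) = br x y + br x z),
      (forall x, br x x = 0) &
      (forall x y z, br x (br y z) + br y (br z x) + br z (br x y) = 0)].

Definition is_addsubgroup (h : nat) (H : set (lat h)) : Prop :=
  H 0 /\ (forall x y, H x -> H y -> H (x - y)).

Definition addgen (h : nat) (S : set (lat h)) : set (lat h) :=
  [set v | forall H, is_addsubgroup H -> S `<=` H -> H v].

(* lower central series: gamma 0 = L (= gamma_1 in the paper),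
   gamma (i+1) = [gamma i, L] (= gamma_{i+2}). *)
Fixpoint lcs (h : nat) (br : lat h -> lat h -> lat h) (i : nat) : set (lat h) :=
  match i with
  | 0 => setT
  | i'.+1 => addgen [set br x y | x in lcs br i' & y in setT]
  end.

Definition nilpotency_class (h : nat) (br : lat h -> lat h -> lat h) (c : nat) : Prop :=
  lcs br c = [set 0] /\ lcs br c.-1 <> [set 0].

Definition has_index (h : nat) (H : set (lat h)) (n : nat) : Prop :=
  exists r : 'I_n -> lat h,
    (forall x, exists i, H (x - r i)) /\ (forall i j, H (r i - r j) -> i = j).

Definition is_subring (h : nat) (br : lat h -> lat h -> lat h) (H : set (lat h)) : Prop :=
  is_addsubgroup H /\ (forall x y, H x -> H y -> H (br x y)).

Definition is_ideal (h : nat) (br : lat h -> lat h -> lat h) (H : set (lat h)) : Prop :=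
  is_addsubgroup H /\ (forall x y, H y -> H (br x y)).

(* a_n^*(L): number of substructures (subrings or ideals, given by P) of index n,
   as an extended real (possibly +oo a priori) *)
Definition a_count (R : realType) (h : nat) (P : set (lat h) -> Prop) (n : nat) : \bar R :=
  (\esum_(H in [set H : set (lat h) | P H /\ has_index H n]) 1)%E.

Definition zeta (R : realType) (h : nat) (P : set (lat h) -> Prop) (s : R) : \bar R :=
  (\sum_(1 <= n <oo) (@a_count R h P n * ((n%:R : R) `^ (- s))%:E))%E.

Definition abscissa (R : realType) (h : nat) (P : set (lat h) -> Prop) : \bar R :=
  ereal_inf [set (s%:E)%E | s in [set s : R | (@zeta R h P s < +oo)%E]].

(* Main.v *)
(* Let [z = row 0 U] be a primitive central vector and [y = row 1 U] a vector,
   both part of a basis [U] of the lattice, with [b [x, y] = a z] and [a <> 0] for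
   some [x]; they come from a nonzero bracket in the last nonzero term of the lower
   central series.  A subgroup [H] of index [n] has a unique Hermite form in the
   basis [U], with diagonal [d_0, ..., d_(h-1)] of product [n], where [d_0] is the
   order of [z] modulo [H]; there are [prod_i d_i^(h-1-i)] forms with a given
   diagonal.  With [D = prod_(i >= 2) d_i], some [D x + * y + * z] and some
   [d_1 y + * z] lie in [H].  If [H] is a subring, their bracket [D d_1 [x, y]] is in
   [H], so [d_0 | a D d_1], whence [d_0 <= |a| sqrt n] and the number of forms is
   [O(n^(h - 3/2))].  If [H] is an ideal, [D [x, y]] is in [H], so [d_0 | a D] and
   the number of forms is [O(n^(h - 2))].  Summing over all diagonals, a bound
   [O(n^e)] yields abscissa at most [e + 1].  In particular [h - 1/2] bounds the
   subring abscissa in every class, and [1/2 >= 1/(c - 1)] when [c > 2]. *)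

Require Import Defs.
From mathcomp Require Import all_boot all_order all_algebra.
From mathcomp Require Import all_classical all_reals all_analysis.
From mathcomp Require Import zify ring lra.
Import Order.TTheory GRing.Theory Num.Theory.
Local Open Scope classical_set_scope.
Local Open Scope ring_scope.

(** * Additive subgroups of finite index *)

Lemma addsubgroupN (h : nat) (H : set (lat h)) (x : lat h) :
  is_addsubgroup H -> H x -> H (- x).
Proof. by case=> H0 HB Hx; rewrite -sub0r; exact: HB. Qed.

Lemma addsubgroupD (h : nat) (H : set (lat h)) (x y : lat h) :
  is_addsubgroup H -> H x -> H y -> H (x + y).
Proof.
move=> HH Hx Hy; rewrite -[y]opprK; apply: (HH.2) => //.
exact: addsubgroupN.
Qed.

Lemma addsubgroupZ (h : nat) (H : set (lat h)) (k : int) (x : lat h) :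
  is_addsubgroup H -> H x -> H (k *: x).
Proof.
move=> HH Hx; elim/int_ind: k => [|n IH|n IH].
- by rewrite scale0r; exact: HH.1.
- by rewrite intS scalerDl scale1r; exact: addsubgroupD.
- by rewrite intS opprD addrC scalerDl scaleN1r; apply: HH.2.
Qed.

(** Pigeonhole: two of the [n + 1] multiples [0, x, ..., n x] fall in the same of the [n] cosets,
    and their difference is the required multiple. *)
Lemma has_index_multiple (h n : nat) (H : set (lat h)) (x : lat h) :
  is_addsubgroup H -> has_index H n ->
  exists m : nat, [/\ (0 < m)%N, (m <= n)%N & H (m%:Z *: x)].
Proof.
move=> HH [r [rP _]].
have [f fP] := choice (fun k : 'I_n.+1 => rP (k%:Z *: x)).
have /injectivePn [k [l]] : ~~ injectiveb f.
  by apply/injectiveP => /leq_card; rewrite !card_ord ltnn.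
wlog kl : k l / (l < k)%N.
  move=> wl; have [lt|lt|/val_inj->] := ltngtP k l.
  - by move=> kl fkl; apply: (wl l k) => //; rewrite eq_sym.
  - exact: wl.
  - by rewrite eqxx.
move=> _ fkl; exists (k - l)%N; split; first by rewrite subn_gt0.
  by have := ltn_ord k; lia.
have := HH.2 _ _ (fP k) (fP l); rewrite fkl opprB addrA subrK -scalerBl.
by rewrite subzn // ltnW.
Qed.

(** * Hermite normal forms *)

(** Keeping the diagonal apart from [A] lets the forms with a given diagonal be counted as functions
    [A] into a product of intervals. *)
Definition hermite_row (h : nat) (d : 'I_h -> nat) (A : 'I_h -> 'I_h -> nat)
  (i : 'I_h) : lat h := \row_j (A i j + d i *+ (i == j))%:Z.

(* The last clause makes the rows generate all of [H]: it says that [d i] is the least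
   positive [i]-th coordinate of a vector of [H] supported on coordinates [<= i]. *)
Definition hermite_form (h : nat) (H : set (lat h)) (d : 'I_h -> nat)
    (A : 'I_h -> 'I_h -> nat) : Prop :=
  [/\ forall i, (0 < d i)%N,
      forall i j, (A i j < if (j < i)%N then d j else 1)%N,
      forall i, H (hermite_row h d A i) &
      forall (i : 'I_h) w, H w -> (forall j : 'I_h, (i < j)%N -> w 0 j = 0) ->
        (d i %| w 0%R i)%Z].

(** Euclidean division from coordinate [k - 1] down to [0]: subtracting a multiple of [u i] leaves
    all coordinates above [i] alone, so nothing already reduced is disturbed. *)
Lemma triangular_reduce (h : nat) (H : set (lat h)) (d : 'I_h -> nat)
    (u : 'I_h -> lat h) (k : nat) (w : lat h) :
  is_addsubgroup H -> (forall i, (0 < d i)%N) -> (forall i, H (u i)) ->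
  (forall i, u i 0 i = d i) ->
  (forall i j : 'I_h, (i < j)%N -> u i 0 j = 0) -> (k <= h)%N ->
  exists v : lat h, [/\ H (w - v),
    forall j : 'I_h, (k <= j)%N -> v 0 j = w 0 j &
    forall j : 'I_h, (j < k)%N -> 0 <= v 0 j < d j].
Proof.
move=> HH d0 Hu ud u0; elim: k w => [|k IH] w kh.
  by exists w; split => //; rewrite subrr; exact: HH.1.
pose i := Ordinal kh; pose q := (w 0%R i %/ d i)%Z.
have [v [Hv vw vb]] := IH (w - q *: u i) (ltnW kh).
exists v; split=> [|j kj|j].
- have -> : w - v = w - q *: u i - v + q *: u i by rewrite addrAC subrK.
  by apply: addsubgroupD => //; exact: addsubgroupZ.
- by rewrite (vw j (ltnW kj)) !mxE u0 // mulr0 subr0.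
- rewrite ltnS leq_eqVlt => /orP[/eqP jk|]; last exact: vb.
  have -> : j = i by exact: val_inj.
  rewrite vw // !mxE ud.
  have -> : w 0 i - q * d i = (w 0%R i %% d i)%Z by rewrite /modz.
  by rewrite modz_ge0 ?ltz_pmod ?ltz_nat // gt_eqF // ltz_nat.
Qed.

Lemma eq_of_multiple_diff (a b q : int) (c : nat) :
  0 <= a < c -> 0 <= b < c -> a - b = q * c -> a = b.
Proof.
move=> ac bc E; have [q1|[q0|q1]] : 1 <= - q \/ q = 0 \/ 1 <= q by lia.
- have : (c : int) <= - q * c by rewrite ler_peMl.
  by rewrite mulNr -E; lia.
- by apply/eqP; rewrite -subr_eq0 E q0 mul0r.
- have : (c : int) <= q * c by rewrite ler_peMl.
  by rewrite -E; lia.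
Qed.

(** Coordinates are compared from the last one down: once those above [j] agree, [d j] divides the
    difference of two residues in [[0, d j)]. *)
Lemma box_inj (h : nat) (H : set (lat h)) (d : 'I_h -> nat) (v w : lat h) :
  is_addsubgroup H ->
  (forall (i : 'I_h) w, H w -> (forall j : 'I_h, (i < j)%N -> w 0 j = 0) ->
        (d i %| w 0%R i)%Z) ->
  (forall j, 0 <= v 0 j < d j) -> (forall j, 0 <= w 0 j < d j) ->
  H (v - w) -> v = w.
Proof.
move=> HH dP vb wb Hvw.
suff eqvw k : forall j : 'I_h, (h - k <= j)%N -> v 0 j = w 0 j.
  by apply/rowP => j; apply: (eqvw h); rewrite subnn.
elim: k => [|k IH] j; first by rewrite subn0 leqNgt ltn_ord.
have [|lt] := leqP (h - k)%N j; first by move=> ? _; exact: IH.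
move=> le.
have := dP j _ Hvw; rewrite !mxE.
case/(_ _)/dvdzP => [l jl|q].
  by rewrite !mxE IH ?subrr //; lia.
by move/(eq_of_multiple_diff _ _ _ _ (vb j) (wb j)).
Qed.

(** The diagonal collects the least positive leading coordinates, and rows reaching them are reduced
    below the diagonal. The box of residues modulo the [d i] then represents each coset exactly
    once, so its size is the index. *)
Lemma hermite_form_exists (h n : nat) (H : set (lat h)) :
  is_addsubgroup H -> has_index H n ->
  exists d A, hermite_form h H d A /\ (\prod_i d i)%N = n.
Proof.
move=> HH Hn.
pose S (i : 'I_h) (m : nat) := (0 < m)%N && `[< exists v : lat h,
  [/\ H v, v 0 i = m & forall j : 'I_h, (i < j)%N -> v 0 j = 0] >].
have S0 i : exists m, S i m.
  have [m [m0 _ Hm]] := has_index_multiple h n H (delta_mx 0 i) HH Hn.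
  exists m; rewrite /S m0; apply/asboolP; exists (m%:Z *: delta_mx 0 i).
  split=> // [|j ij]; rewrite !mxE ?eqxx /= ?mulr1 //.
  by rewrite -val_eqE /= gtn_eqF // mulr0.
pose d i := ex_minn (S0 i).
have d0 i : (0 < d i)%N by rewrite /d; case: ex_minnP => m /andP[].
have /choice[u uP] i : exists v : lat h,
  [/\ H v, v 0 i = d i & forall j : 'I_h, (i < j)%N -> v 0 j = 0].
  by rewrite /d; case: ex_minnP => m /andP[_ /asboolP].
have Hu i : H (u i) by have [] := uP i.
have ud i : u i 0 i = d i by have [] := uP i.
have u0 (i j : 'I_h) : (i < j)%N -> u i 0 j = 0 by have [_ _] := uP i; exact.
have dP (i : 'I_h) w : H w -> (forall j : 'I_h, (i < j)%N -> w 0 j = 0) ->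
    (d i %| w 0%R i)%Z.
  (* A nonzero remainder would be a positive leading coordinate smaller than the minimum [d i]. *)
  move=> Hw w0; apply/dvdz_mod0P; apply/eqP/negPn/negP => nz.
  pose q := (w 0%R i %/ d i)%Z.
  have : S i `|(w 0%R i %% d i)%Z|%N.
    rewrite /S absz_gt0 nz; apply/asboolP; exists (w - q *: u i); split.
    - by apply: HH.2 => //; exact: addsubgroupZ.
    - rewrite !mxE ud gez0_abs ?modz_ge0 // gt_eqF // ltz_nat; exact: d0.
    - by move=> j ij; rewrite !mxE w0 ?u0 // mulr0 subr0.
  have := @ltz_pmod (w 0 i) (d i); rewrite ltz_nat d0 => /(_ isT).
  have : 0 <= (w 0%R i %% d i)%Z by rewrite modz_ge0 // gt_eqF ?ltz_nat.
  rewrite [X in _ -> (_ < Posz X) -> _]/d.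
  case: ex_minnP => m _ mmin m1 m2 /mmin; lia.
have red w : exists v : lat h, H (w - v) /\ (forall j, 0 <= v 0 j < d j).
  have [v [Hv _ vb]] := triangular_reduce h H d u h w HH d0 Hu ud u0 (leqnn h).
  by exists v; split=> // j; exact: vb.
have redrow (i : 'I_h) : exists v : lat h, [/\ H v,
    forall j : 'I_h, (i <= j)%N -> v 0 j = u i 0 j &
    forall j : 'I_h, (j < i)%N -> 0 <= v 0 j < d j].
  have [v [Hv vu vb]] :=
    triangular_reduce h H d u i (u i) HH d0 Hu ud u0 (ltnW (ltn_ord i)).
  exists v; split=> //; rewrite -[v](subKr (u i)); exact: HH.2.
have /choice[v vP] := redrow.
(* The reduced entries are nonnegative, so taking absolute values loses nothing. *)
pose A (i j : 'I_h) := if (j < i)%N then `|v i 0%R j|%N else 0%N.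
exists d, A; split.
  split=> // [i j|i].
  - rewrite /A; case: ifP => // ji; have [_ _ /(_ j ji)] := vP i; lia.
  - have [Hv vu vb] := vP i.
    suff -> : hermite_row h d A i = v i by [].
    apply/rowP => j; rewrite mxE /A; case: ifP => ji.
      have := vb j ji => vbj.
      have -> : (i == j) = false by rewrite -val_eqE /= gtn_eqF.
      by rewrite addn0 gez0_abs; lia.
    have ij : (i <= j)%N by rewrite leqNgt ji.
    rewrite (vu j ij) add0n; have [<-|nij] := eqVneq i j; first by rewrite ud.
    by rewrite u0 // ltn_neqAle ij andbT.
(* Box points and cosets inject into each other: [f] sends a point to its coset, and [g] reduces a
   coset representative into the box. *)
have [r [rP rinj]] := Hn.
pose T := {dffun forall i : 'I_h, 'I_(d i)}.
have <- : #|{: T}| = (\prod_i d i)%N.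
  rewrite card_dep_ffun foldrE big_map big_enum /=.
  by apply: eq_bigr => i _; rewrite card_ord.
pose vec (t : T) : lat h := \row_j (t j : nat)%:Z.
have vecb t j : 0 <= vec t 0 j < d j by rewrite mxE /=; have := ltn_ord (t j); lia.
have /choice[f fP] (t : T) : exists i, H (vec t - r i) by exact: rP.
have finj : injective f.
  move=> t t' ff; have := HH.2 _ _ (fP t) (fP t').
  rewrite ff opprB addrA subrK => /(box_inj h H d _ _ HH dP (vecb t) (vecb t')).
  move/rowP => E; apply/ffunP => j; apply: val_inj; have := E j; rewrite !mxE.
  by case.
have /choice[g gP] (i : 'I_n) : exists t, H (r i - vec t).
  have [w [Hw wb]] := red (r i).
  have lt j : (`|w 0%R j| < d j)%N by have := wb j; lia.
  exists [ffun j => Ordinal (lt j)].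
  have -> // : vec [ffun j => Ordinal (lt j)] = w.
  by apply/rowP => j; rewrite mxE ffunE /= gez0_abs //; have /andP[] := wb j.
have ginj : injective g.
  move=> i j gg; apply: rinj; have := HH.2 _ _ (gP i) (gP j).
  by rewrite gg opprB addrA subrK.
apply/eqP; rewrite eqn_leq; apply/andP; split.
  by have := leq_card f finj; rewrite card_ord.
by have := leq_card g ginj; rewrite card_ord.
Qed.

(** The rows generate [H]: a vector of [H] is cleared from its last coordinate down, since each
    leading coordinate is a multiple of the diagonal entry of its row. The same rows lie in [K]. *)
Lemma hermite_form_sub (h : nat) (H K : set (lat h)) d A :
  is_addsubgroup H -> is_addsubgroup K ->
  hermite_form h H d A -> hermite_form h K d A -> H `<=` K.
Proof.
move=> HH KK [d0 Ab Hr dP] [_ _ Kr _] w.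
suff main k : (k <= h)%N -> forall w, H w ->
    (forall j : 'I_h, (k <= j)%N -> w 0 j = 0) -> K w.
  by move=> Hw; apply: (main h (leqnn h)) => // j; rewrite leqNgt ltn_ord.
elim: k => [|k IH] kh {}w Hw w0.
  by have -> : w = 0; [apply/rowP => j; rewrite w0 // mxE | exact: KK.1].
pose i := Ordinal kh; have /dvdzP[q wq] := dP i w Hw w0.
pose u := q *: hermite_row h d A i.
have Ai (j : 'I_h) : (i <= j)%N -> A i j = 0%N.
  by move=> ij; have := Ab i j; rewrite (ltnNge j i) ij /=; case: (A i j).
rewrite -[w](subrK u); apply: addsubgroupD => //; last exact: addsubgroupZ.
apply: IH; first exact: ltnW.
  by apply: HH.2 => //; exact: addsubgroupZ.
move=> j; rewrite leq_eqVlt => /orP[/eqP kj|kj].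
  have <- : i = j by exact: val_inj.
  by rewrite !mxE wq Ai // eqxx subrr.
by rewrite !mxE (w0 j kj) (Ai j (ltnW kj)) -val_eqE /= ltn_eqF // mulr0 subrr.
Qed.

Lemma hermite_form_inj (h : nat) (H K : set (lat h)) d A :
  is_addsubgroup H -> is_addsubgroup K ->
  hermite_form h H d A -> hermite_form h K d A -> H = K.
Proof.
by move=> HH KK fH fK; apply/seteqP; split; apply: hermite_form_sub;
  try eassumption.
Qed.

(** Modulo the first [k] coordinates, [H] has index the product of the [d i] with [k <= i], and this
    index kills the quotient. The induction lowers [k] from [h], using one row at a time. *)
Lemma hermite_multiple (h : nat) (H : set (lat h)) d A (k : nat) (w : lat h) :
  is_addsubgroup H -> hermite_form h H d A -> (k <= h)%N ->
  exists2 v, H v & forall j : 'I_h, (k <= j)%N ->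
    v 0 j = (\prod_(i < h | (k <= i)%N) d i)%N%:Z * w 0 j.
Proof.
move=> HH [d0 Ab Hr dP] kh.
rewrite -(subKn kh); elim: (h - k)%N (leq_subr k h) => {k kh} [|m IH] mh.
  exists 0 => [|j]; first exact: HH.1.
  by rewrite subn0 leqNgt ltn_ord.
have [v Hv vw] := IH (ltnW mh).
have kh : (h - m.+1 < h)%N by lia.
pose i := Ordinal kh.
have prodE : (\prod_(j < h | (h - m.+1 <= j)%N) d j =
    d i * \prod_(j < h | (h - m <= j)%N) d j)%N.
  rewrite (bigD1 i) //=; congr muln; apply: eq_bigl => j.
  by rewrite -val_eqE /=; lia.
pose D := (\prod_(j < h | (h - m <= j)%N) d j)%N.
(* Chosen so that coordinate [i] becomes [d_i v_i + q d_i = d_i D w_i]. *)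
pose q := D%:Z * w 0 i - v 0 i.
exists ((d i)%:Z *: v + q *: hermite_row h d A i).
  by apply: addsubgroupD => //; exact: addsubgroupZ.
have Ai (j : 'I_h) : (i <= j)%N -> A i j = 0%N.
  by move=> ij; have := Ab i j; rewrite (ltnNge j i) ij /=; case: (A i j).
move=> j kj; rewrite prodE !mxE Ai // PoszM -/D.
have [<-|ij] := eqVneq i j.
  rewrite /q /= add0n; ring.
rewrite /= addn0 mulr0 addr0 vw ?mulrA //.
by move: ij kj; rewrite -val_eqE /=; lia.
Qed.

(** * Bilinearity and antisymmetry of the bracket *)

Lemma lie_bracketZl (h : nat) (br : lat h -> lat h -> lat h) (k : int) x y :
  is_lie_bracket br -> br (k *: x) y = k *: br x y.
Proof.
case=> brDl _ _ _.
have br0 : br 0 y = 0 by apply: (addrI (br 0 y)); rewrite -brDl !addr0.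
have brN u : br (- u) y = - br u y.
  by apply: (addrI (br u y)); rewrite -brDl !subrr.
elim/int_ind: k => [|n IH|n IH].
- by rewrite !scale0r.
- by rewrite intS !scalerDl !scale1r brDl IH.
- by rewrite intS opprD !scalerDl !scaleN1r brDl brN IH.
Qed.

Lemma lie_bracketC (h : nat) (br : lat h -> lat h -> lat h) x y :
  is_lie_bracket br -> br y x = - br x y.
Proof.
case=> brDl brDr brxx _; apply/eqP; rewrite -addr_eq0; apply/eqP.
by have := brxx (y + x); rewrite brDl !brDr !brxx add0r addr0.
Qed.

Lemma lie_bracketZr (h : nat) (br : lat h -> lat h -> lat h) (k : int) x y :
  is_lie_bracket br -> br x (k *: y) = k *: br x y.
Proof.
move=> Hb; rewrite (lie_bracketC _ _ (k *: y)) // lie_bracketZl //.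
by rewrite (lie_bracketC _ _ x) // scalerN opprK.
Qed.

(** * Adapted bases and change of basis *)

(** In the Smith normal form of a one-row matrix, only the first row of the right unimodular factor
    contributes. *)
Lemma primitive_row (g : nat) (v : lat g.+1) :
  exists2 U : 'M[int]_g.+1, U \in unitmx & exists a : int, v = a *: row 0 U.
Proof.
have [L _ [U Uu [d _ vE]]] := int_Smith_normal_form v.
exists U => //; exists (L 0 0 * d`_0); rewrite {1}vE.
rewrite -[_ *m U]/(mulmx _ _) mulmx_sum_row big_ord_recl big1 ?addr0 => [|i _].
  by rewrite mxE big_ord_recl big_ord0 !mxE addr0.
by rewrite mxE big_ord_recl big_ord0 !mxE /= mulr0 addr0 scale0r.
Qed.

(** First [z] is made a multiple of a basis vector; then the remaining coordinates of [y] are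
    treated likewise. The block matrix [B] performs the second change while fixing the first basis
    vector. *)
Lemma adapted_basis (g : nat) (z y : lat g.+2) :
  exists2 U : 'M[int]_g.+2, U \in unitmx &
    exists a b c : int,
      z = a *: row 0 U /\ y = c *: row 0 U + b *: row (lift 0 0) U.
Proof.
have [U1 U1u [a za]] := primitive_row _ z.
pose y' : 'rV[int]_(1 + g.+1) := y *m invmx U1.
have [U2 U2u [b yb]] := primitive_row _ (rsubmx y').
pose B : 'M[int]_(1 + g.+1) := block_mx 1%:M 0 0 U2.
have Bu : B \in unitmx.
  by rewrite unitmxE det_ublock det1 mul1r -unitmxE.
have B0 : row 0 B = row_mx 1%:M 0.
  rewrite (_ : row 0 B = row (lshift g.+1 (0 : 'I_1)) B); last first.
    by congr row; exact: val_inj.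
  rewrite /B /block_mx rowKu row_row_mx row0; congr row_mx.
  by apply/rowP => i; rewrite !mxE !ord1.
have B1 : row (lift 0 0) B = row_mx 0 (row 0 U2).
  rewrite (_ : row _ B = row (rshift 1 (0 : 'I_g.+1)) B); last first.
    by congr row; exact: val_inj.
  by rewrite /B /block_mx rowKd row_row_mx row0.
exists (B *m U1); first by rewrite unitmx_mul Bu.
exists a, b, (lsubmx y' 0 0); rewrite !row_mul B0 B1; split.
  rewrite za rowE; congr (_ *: (_ *m _)); apply/rowP => j.
  rewrite !mxE; case: splitP => [k|k]; [rewrite (ord1 k)|]; rewrite !mxE => jk.
    by have -> : j == 0 by rewrite -val_eqE /= jk.
  by have -> : (j == 0) = false by rewrite -val_eqE /= jk.
rewrite !scalemxAl -mulmxDl !scale_row_mx !scaler0 add_row_mx addr0 add0r -yb.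
rewrite scalemx1 -mx11_scalar hsubmxK.
by rewrite mulmxKV.
Qed.

Lemma mulmx_two_rows (g : nat) (U : 'M[int]_g.+2) (u : lat g.+2) :
  (forall j : 'I_g.+2, (1 < j)%N -> u 0 j = 0) ->
  u *m U = u 0 0 *: row 0 U + u 0 (lift 0 0) *: row (lift 0 0) U.
Proof.
move=> u0; rewrite mulmx_sum_row !big_ord_recl big1 ?addr0 // => i _.
by rewrite u0 ?scale0r.
Qed.

Lemma addsubgroup_preim (h : nat) (H : set (lat h)) (U : 'M[int]_h) :
  is_addsubgroup H -> is_addsubgroup [set w | H (w *m U)].
Proof.
case=> H0 HB; split=> [|x y]; rewrite /= ?mul0mx // mulmxBl; exact: HB.
Qed.

Lemma has_index_preim (h n : nat) (H : set (lat h)) (U : 'M[int]_h) :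
  U \in unitmx -> has_index H n -> has_index [set w | H (w *m U)] n.
Proof.
move=> Uu [r [rP rinj]]; exists (fun i => r i *m invmx U); split=> [x|i j] /=.
  by have [i Hi] := rP (x *m U); exists i; rewrite mulmxBl mulmxKV.
by rewrite mulmxBl !mulmxKV //; exact: rinj.
Qed.

Lemma prod_ord_ge2 (g : nat) (d : 'I_g.+2 -> nat) :
  (\prod_i d i = d 0%R * (d (lift 0%R 0%R) * \prod_(i < g.+2 | 2 <= i) d i))%N.
Proof.
rewrite (bigD1 0) //= (bigD1 (lift 0 0)) //=; congr (_ * (_ * _))%N.
by apply: eq_bigl => i; rewrite -!val_eqE /=; case: i => [[|[|]]].
Qed.

(** * Constraints that brackets put on the diagonal *)

(** Multiplying the given vector of [H] by [b] puts [k a] times [row 0 U] in [H]. The order [d 0] of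
    [row 0 U] modulo [H] therefore divides the nonzero integer [k a]. *)
Lemma bracket_diag (g : nat) (br : lat g.+2 -> lat g.+2 -> lat g.+2)
    (U : 'M[int]_g.+2) (x : lat g.+2) (a b : int) (H : set (lat g.+2)) d A k :
  U \in unitmx -> a != 0 -> b *: br x (row (lift 0 0) U) = a *: row 0 U ->
  is_addsubgroup H -> hermite_form _ [set w | H (w *m U)] d A -> (0 < k)%N ->
  H (k%:Z *: br x (row (lift 0 0) U)) -> (d 0%R <= `|a| * k)%N.
Proof.
move=> Uu a0 bE HH [_ _ _ dP] k0 Hk.
have : H (((k%:Z * a) *: delta_mx 0 0) *m U).
  rewrite -scalemxAl -rowE -scalerA -bE scalerA mulrC -scalerA.
  exact: addsubgroupZ.
move=> /(dP 0) dv; have {dv} : (d 0%R %| k%:Z * a)%Z.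
  have -> : k%:Z * a = ((k%:Z * a) *: delta_mx 0 0 : lat g.+2) 0 0.
    by rewrite !mxE !eqxx mulr1.
  by apply: dv => j j0; rewrite !mxE eqxx -val_eqE /= gtn_eqF // mulr0.
move=> /dvdn_leq; rewrite abszM absz_nat mulnC; apply.
by rewrite muln_gt0 k0 absz_gt0 a0.
Qed.

(** The vector [v] agrees with a multiple of [x] up to the first two basis vectors, which both
    commute with the second one. The vector [t] is the second Hermite row, whose component along the
    first basis vector is central. *)
Lemma bracket_hermite (g : nat) (br : lat g.+2 -> lat g.+2 -> lat g.+2)
    (U : 'M[int]_g.+2) (x : lat g.+2) (H : set (lat g.+2)) d A :
  is_lie_bracket br -> U \in unitmx -> (forall v, br v (row 0 U) = 0) ->
  is_addsubgroup H -> hermite_form _ [set w | H (w *m U)] d A ->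
  exists v : lat g.+2, [/\ H v,
    br v (row (lift 0 0) U) =
      (\prod_(i < g.+2 | 2 <= i) d i)%N%:Z *: br x (row (lift 0 0) U) &
    exists2 t : lat g.+2, H t &
      br v t = (d (lift 0%R 0%R) * \prod_(i < g.+2 | 2 <= i) d i)%N%:Z *:
        br x (row (lift 0 0) U)].
Proof.
move=> Hb Uu zc HH hf; have [brDl brDr brxx _] := Hb.
have [v Hv vE] := hermite_multiple _ _ d A 2 (x *m invmx U)
  (addsubgroup_preim _ _ U HH) hf isT.
set D := (\prod_(i < _ | _) _)%N in vE *.
have brv : br (v *m U) (row (lift 0 0) U) = D%:Z *: br x (row (lift 0 0) U).
  have -> : v *m U = D%:Z *: x + (v - D%:Z *: (x *m invmx U)) *m U.
    by rewrite mulmxBl -scalemxAl mulmxKV // addrC subrK.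
  rewrite mulmx_two_rows => [|j j1]; last by rewrite mxE vE // !mxE subrr.
  rewrite !brDl !(lie_bracketZl _ br) // brxx scaler0 addr0.
  by rewrite (lie_bracketC _ _ _ (row 0 U)) // zc oppr0 scaler0 addr0.
exists (v *m U); split => //.
have [_ Ab Hr _] := hf.
exists (hermite_row _ d A (lift 0 0) *m U); first exact: Hr.
have A1 (j : 'I_g.+2) : (1 <= j)%N -> A (lift 0 0) j = 0%N.
  by move=> j1; have := Ab (lift 0 0) j; rewrite (ltnNge j) j1 /=; case: (A _ _).
rewrite (mulmx_two_rows _ _ (hermite_row _ _ _ _)) => [|j j1]; last first.
  by rewrite /hermite_row mxE A1 ?(ltnW j1) // -val_eqE /= ltn_eqF.
rewrite brDr !(lie_bracketZr _ br) // zc scaler0 add0r brv.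
by rewrite /hermite_row mxE A1 // eqxx scalerA -PoszM.
Qed.

Lemma subring_diag (g : nat) (br : lat g.+2 -> lat g.+2 -> lat g.+2)
    (U : 'M[int]_g.+2) (x : lat g.+2) (a b : int) (H : set (lat g.+2)) d A :
  is_lie_bracket br -> U \in unitmx -> (forall v, br v (row 0 U) = 0) ->
  a != 0 -> b *: br x (row (lift 0 0) U) = a *: row 0 U ->
  is_subring br H -> hermite_form _ [set w | H (w *m U)] d A ->
  (d 0%R <= `|a| * (d (lift 0%R 0%R) * \prod_(i < g.+2 | 2 <= i) d i))%N.
Proof.
move=> Hb Uu zc a0 bE [HH Hbr] hf.
have [v [Hv _ [t Ht brE]]] := bracket_hermite _ br U x H d A Hb Uu zc HH hf.
have [d0 _ _ _] := hf.
apply: bracket_diag; try eassumption.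
- by rewrite muln_gt0 d0 prodn_gt0.
- by rewrite -brE; exact: Hbr.
Qed.

Lemma ideal_diag (g : nat) (br : lat g.+2 -> lat g.+2 -> lat g.+2)
    (U : 'M[int]_g.+2) (x : lat g.+2) (a b : int) (H : set (lat g.+2)) d A :
  is_lie_bracket br -> U \in unitmx -> (forall v, br v (row 0 U) = 0) ->
  a != 0 -> b *: br x (row (lift 0 0) U) = a *: row 0 U ->
  is_ideal br H -> hermite_form _ [set w | H (w *m U)] d A ->
  (d 0%R <= `|a| * \prod_(i < g.+2 | 2 <= i) d i)%N.
Proof.
move=> Hb Uu zc a0 bE [HH Hbr] hf.
have [v [Hv brE _]] := bracket_hermite _ br U x H d A Hb Uu zc HH hf.
have [d0 _ _ _] := hf.
apply: bracket_diag; try eassumption; first exact: prodn_gt0.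
rewrite -brE (lie_bracketC _ _ (row (lift 0 0) U)) //.
by apply: addsubgroupN => //; exact: Hbr.
Qed.

(** * A nonzero central bracket and its frame *)

(** Brackets lying in the last nonzero term are central, and they cannot all vanish because they
    generate that term. *)
Lemma lcs_last_bracket (h c : nat) (br : lat h -> lat h -> lat h) :
  is_lie_bracket br -> (exists x y, br x y <> 0) -> nilpotency_class br c ->
  exists x y, br x y != 0 /\ forall v, br v (br x y) = 0.
Proof.
move=> Hb [x0 [y0 xy0]] [cE c1E].
have gen0 (S : set (lat h)) v : S v -> addgen S v by move=> Sv H _ SH; exact: SH.
(* Class [0] is contradictory because [0.-1] is [0]; class [1] would make every bracket vanish. *)
case: c cE c1E => [//|[|c]] cE c1E.
  case: xy0; have : lcs br 1 (br x0 y0) by apply: (gen0 _ _); exists x0 => //; exists y0.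
  by rewrite cE.
have [[x [y [xc xy]]]|nex] := pselect (exists x y, lcs br c x /\ br x y <> 0).
  exists x, y; split=> [|v]; first exact/eqP.
  rewrite (lie_bracketC _ _ (br x y)) //.
  have : lcs br c.+2 (br (br x y) v).
    apply: (gen0 _ _); exists (br x y); last by exists v.
    by apply: (gen0 _ _); exists x => //; exists y.
  by rewrite cE => ->; rewrite oppr0.
case: c1E; rewrite -[lcs br _]/(addgen [set br x y | x in lcs br c & y in setT]).
apply/seteqP; split=> [v vg|v ->]; last by move=> H [].
apply: (vg [set 0]); first by split=> // ? ? -> ->; rewrite subrr.
move=> _ [x xc [y _ <-]]; apply: contrapT => xy.
by apply: nex; exists x, y.
Qed.

Lemma bracket_rank1 (br : lat 1 -> lat 1 -> lat 1) x y :
  is_lie_bracket br -> br x y = 0.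
Proof.
move=> Hb; have [_ _ brxx _] := Hb.
have mx1 (v : lat 1) : v = v 0 0 *: const_mx 1.
  by apply/rowP => i; rewrite !mxE ord1 mulr1.
by rewrite (mx1 x) (mx1 y) lie_bracketZl // lie_bracketZr // brxx !scaler0.
Qed.

(** Centrality passes from the bracket to the primitive vector below it because the lattice is
    torsion-free. The central component of [y] drops out of the bracket, which leaves the factor
    [b]. *)
Lemma adapted_frame (g c : nat) (br : lat g.+2 -> lat g.+2 -> lat g.+2) :
  is_lie_bracket br -> (exists x y, br x y <> 0) -> nilpotency_class br c ->
  exists U : 'M[int]_g.+2, exists (x : lat g.+2) (a b : int),
    [/\ U \in unitmx, forall v, br v (row 0 U) = 0, a != 0 &
        b *: br x (row (lift 0 0) U) = a *: row 0 U].
Proof.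
move=> Hb Hn Hc; have [_ brDr _ _] := Hb.
have [x [y [z0 zc]]] := lcs_last_bracket _ _ _ Hb Hn Hc.
have [U Uu [a [b [c' [zE yE]]]]] := adapted_basis _ (br x y) y.
have a0 : a != 0 by apply: contraNneq z0 => a0; rewrite zE a0 scale0r.
have Uc v : br v (row 0 U) = 0.
  have := zc v; rewrite zE lie_bracketZr // => /rowP E; apply/rowP => j.
  by have /eqP := E j; rewrite !mxE mulf_eq0 (negbTE a0) => /eqP.
exists U, x, a, b; split=> //.
by rewrite -zE yE brDr !(lie_bracketZr _ br) // Uc scaler0 add0r.
Qed.

(** * Partial sums of the Riemann zeta series *)

Lemma zeta_partial_sum_bounded (R : realType) (t : R) :
  1 < t -> exists Z : R, forall N, \sum_(0 <= k < N) k%:R `^ (- t) <= Z.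
Proof.
move=> t1; pose q : R := 2 `^ (1 - t).
have q0 : 0 <= q by exact: powR_ge0.
have q1 : q < 1.
  rewrite /q -opprB powRN invf_lt1 ?powR_gt0 //.
  rewrite -[X in X < _](_ : 1 `^ (t - 1) = 1); last by rewrite powR1.
  by rewrite gt0_ltr_powR ?nnegrE ?subr_gt0 ?ltr1n.
exists (1 - q)^-1 => N.
(* The terms with [2 ^ m <= k < 2 ^ m.+1] add up to at most [q ^+ m]. *)
have dyadic m : \sum_(0 <= k < 2 ^ m) k%:R `^ (- t) <= (1 - q ^+ m) / (1 - q).
  elim: m => [|m IH].
    (* The term [k = 0] vanishes, as [0] to a nonzero power is [0] by convention. *)
    rewrite expn0 big_nat1 powR0 ?expr0 ?subrr ?mul0r //.
    by rewrite oppr_eq0 gt_eqF // (lt_trans ltr01).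
  have le2 : (2 ^ m <= 2 ^ m.+1)%N by rewrite leq_exp2l.
  rewrite (big_cat_nat _ (n := 2 ^ m)) //=.
  have : \sum_(2 ^ m <= k < 2 ^ m.+1) k%:R `^ (- t) <= q ^+ m.
    apply: (@le_trans _ _ (\sum_(2 ^ m <= k < 2 ^ m.+1) (2 ^ m)%:R `^ (- t))).
      apply: ler_sum_nat => k /andP[mk _].
      rewrite !powRN lef_pV2 ?posrE ?powR_gt0 ?ltr0n ?expn_gt0 //; last first.
        by rewrite (leq_trans _ mk) ?expn_gt0.
      by rewrite ge0_ler_powR ?nnegrE ?ler_nat //; lra.
    rewrite sumr_const_nat expnS mul2n -addnn addnK.
    rewrite -[leLHS]mulr_natl natrX -powR_mulrn // -powRrM.
    rewrite -powRD ?pnatr_eq0 ?implybT // -(powR_mulrn m q0) /q -powRrM.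
    by rewrite le_eqVlt; apply/orP; left; apply/eqP; congr (_ `^ _); ring.
  move=> le1; apply: le_trans (lerD IH le1) _.
  rewrite exprS -[leLHS](mulfK (_ : 1 - q != 0)) ?subr_eq0 ?gt_eqF //.
  rewrite ler_pM2r ?invr_gt0 ?subr_gt0 // mulrDl divfK ?subr_eq0 ?gt_eqF //.
  by rewrite le_eqVlt; apply/orP; left; apply/eqP; ring.
have N2 : (N <= 2 ^ N)%N by rewrite ltnW // ltn_expl.
apply: (@le_trans _ _ (\sum_(0 <= k < 2 ^ N) k%:R `^ (- t))).
  rewrite [leRHS](big_cat_nat _ (n := N)) //= lerDl.
  by apply: sumr_ge0 => k _; exact: powR_ge0.
apply: le_trans (dyadic N) _; rewrite -[leRHS]mul1r ler_pM2r ?invr_gt0 ?subr_gt0 //.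
by rewrite gerBl exprn_ge0.
Qed.

(** * Counting subgroups by their Hermite forms *)

Lemma esum1_le_card (R : realType) (T : choiceType) (F : finType) (S : set T)
    (f : T -> F) (Q : {pred F}) :
  (forall x, S x -> f x \in Q) ->
  (forall x y, S x -> S y -> f x = f y -> x = y) ->
  (\esum_(x in S) 1 <= (#|Q|%:R : R)%:E)%E.
Proof.
move=> fQ finj; apply: ge_ereal_sup => _ [X [finX XS] <-].
rewrite fsbig_finite //= sumEFin lee_fin big_const_seq count_predT.
rewrite iter_addr_0 ler_nat cardE -(size_map f).
apply: uniq_leq_size => [|_ /mapP[x + ->]].
  rewrite map_inj_in_uniq ?fset_uniq // => x y.
  rewrite !in_fset_set // !inE => /XS Sx /XS Sy; exact: finj.
by rewrite in_fset_set // inE mem_enum => /XS; exact: fQ.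
Qed.

Lemma card_ord_between (N a b : nat) :
  (#|[pred i : 'I_N | a <= i < b]| <= b - a)%N.
Proof.
rewrite cardE -(size_map val) -[X in (_ <= X)%N](size_iota a).
apply: uniq_leq_size => [|_ /mapP[i + ->]].
  by rewrite map_inj_uniq ?enum_uniq //; exact: val_inj.
rewrite mem_enum !inE mem_iota /= => /andP[ai ib]; lia.
Qed.

(** Column [j] has [h - j - 1] places below the diagonal, each with at most [d j] values; every
    other entry is forced to be [0]. *)
Lemma card_hermite_family (h N : nat) (d : 'I_h -> nat) :
  (forall i, (0 < d i)%N) ->
  (#|family (fun ij : 'I_h * 'I_h =>
      [pred a : 'I_N | a < if ij.2 < ij.1 then d ij.2 else 1])|
   <= \prod_i d i ^ (h - i.+1))%N.
Proof.
move=> d0; rewrite card_family foldrE big_map big_enum /=.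
pose w (i j : 'I_h) := if (j < i)%N then d j else 1%N.
apply: (@leq_trans (\prod_(ij : 'I_h * 'I_h) w ij.1 ij.2)).
  by apply: leq_prod => -[i j] _; have := card_ord_between N 0 (w i j); rewrite subn0.
rewrite -(pair_bigA _ w) exchange_big /=; apply: leq_prod => j _.
rewrite -big_mkcond prod_nat_const leq_pexp2l // -[X in (_ <= X - _)%N]/h.
apply: leq_trans (card_ord_between h j.+1 h); apply/eq_leq/eq_card => i.
by rewrite !inE ltn_ord andbT.
Qed.

Lemma natr_prod_powR (R : realType) (I : finType) (d : I -> nat) (u : R) :
  (\prod_i d i)%N%:R `^ u = \prod_i (d i)%:R `^ u.
Proof.
elim/big_rec2: _ => [|i x y _ <-]; first by rewrite powR1.
by rewrite natrM powRM ?ler0n.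
Qed.

Lemma leq_prod_factor (I : finType) (d : I -> nat) (i : I) :
  (forall i, (0 < d i)%N) -> (d i <= \prod_j d j)%N.
Proof.
by move=> d0; rewrite (bigD1 i) //= leq_pmulr // prodn_gt0.
Qed.

(** Subgroups inject into pairs of a diagonal and an array of entries, all below [N]. The weight
    bound is asked only of diagonals that occur for some [H], because only these obey the bracket
    constraint. *)
Lemma a_count_le (R : realType) (h : nat) (P : set (lat h) -> Prop)
    (U : 'M[int]_h) (C : R) (n N : nat) :
  U \in unitmx -> 0 <= C -> (forall H, P H -> is_addsubgroup H) ->
  (0 < n < N)%N ->
  (forall H d A, P H -> has_index H n ->
    hermite_form h [set w | H (w *m U)] d A -> (\prod_i d i)%N = n ->
    (\prod_(i < h) d i ^ (h - i.+1))%N%:R <= C) ->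
  (@a_count R h P n <=
    (C * #|[pred d : {ffun 'I_h -> 'I_N} | \prod_i d i == n]%N|%:R)%:E)%E.
Proof.
case: N => [|N] Uu C0 PH /andP[n0 nN] hC; first by rewrite ltn0 in nN.
pose S := [set H : set (lat h) | P H /\ has_index H n].
have code H : exists p : ('I_h -> nat) * ('I_h -> 'I_h -> nat), S H ->
    hermite_form h [set w | H (w *m U)] p.1 p.2 /\ (\prod_i p.1 i)%N = n.
  have [[PHH Hn]|nS] := pselect (S H); last by exists (fun=> 0, fun _ _ => 0)%N.
  have [d [A dA]] := hermite_form_exists h n _
    (addsubgroup_preim h H U (PH _ PHH)) (has_index_preim h n H U Uu Hn).
  by exists (d, A).
have [p pP] := choice code.
pose f H : {ffun 'I_h -> 'I_N.+1} * {ffun 'I_h * 'I_h -> 'I_N.+1} :=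
  ([ffun i => inord ((p H).1 i)], [ffun ij => inord ((p H).2 ij.1 ij.2)]).
have dN H i : S H -> ((p H).1 i < N.+1)%N.
  move=> /pP[[d0 _ _ _] dn]; apply: leq_ltn_trans nN; rewrite -dn.
  exact: leq_prod_factor.
have AN H i j : S H -> ((p H).2 i j < N.+1)%N.
  move=> SH; have [[d0 Ab _ _] _] := pP H SH; apply: leq_trans (Ab i j) _.
  by case: ifP => // _; exact/ltnW/dN.
pose good (d : {ffun 'I_h -> 'I_N.+1}) :=
  (\prod_i d i == n)%N && ((\prod_(i < h) d i ^ (h - i.+1))%N%:R <= C).
pose fam (d : {ffun 'I_h -> 'I_N.+1}) := family (fun ij : 'I_h * 'I_h =>
      [pred a : 'I_N.+1 | (a < if (ij.2 < ij.1)%N then (d ij.2 : nat) else 1)%N]).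
apply: le_trans (@esum1_le_card R _ _ S f
  [pred x | good x.1 && (x.2 \in fam x.1)] _ _) _.
- move=> H SH; have [hf dn] := pP H SH; have [PHH Hn] := SH; have [d0 Ab _ _] := hf.
  rewrite inE /good; apply/andP; split; last first.
    apply/familyP => -[i j]; rewrite !ffunE !inE /= !inordK ?dN ?AN //.
  apply/andP; split.
    by apply/eqP; rewrite -dn; apply: eq_bigr => i _; rewrite ffunE inordK ?dN.
  rewrite (eq_bigr (fun i : 'I_h => (p H).1 i ^ (h - i.+1))%N) => [|i _].
    by apply: (hC H (p H).1 (p H).2) => //.
  by rewrite ffunE inordK ?dN.
- move=> H K SH SK [/ffunP fd /ffunP fA].
  have ed : (p H).1 = (p K).1.
    apply/funext => i; have /(congr1 val) := fd i.
    by rewrite !ffunE /= !inordK ?dN.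
  have eA : (p H).2 = (p K).2.
    apply/funext => i; apply/funext => j; have /(congr1 val) := fA (i, j).
    by rewrite !ffunE /= !inordK ?AN.
  have [hH _] := pP H SH; have [hK _] := pP K SK; rewrite ed eA in hH.
  have E := hermite_form_inj h _ _ _ _ (addsubgroup_preim h H U (PH _ SH.1))
    (addsubgroup_preim h K U (PH _ SK.1)) hH hK.
  (* Equal preimages under the invertible [U] come from equal subgroups. *)
  apply/seteqP; split=> w Hw.
    have : [set w | H (w *m U)] (w *m invmx U) by rewrite /= mulmxKV.
    by rewrite E /= mulmxKV.
  have : [set w | K (w *m U)] (w *m invmx U) by rewrite /= mulmxKV.
  by rewrite -E /= mulmxKV.
(* Summing over diagonals first: a good diagonal carries at most its weight, hence at most [C],
   arrays. *)
rewrite lee_fin -sum1_card -(pair_big_dep good fam (fun _ _ => 1%N)) /=.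
rewrite natr_sum -[X in _ * X]mulr1n -sumr_const mulr_sumr mulr1.
rewrite big_mkcond [leRHS]big_mkcond /=; apply: ler_sum => d _.
rewrite /good inE; case: eqP => //= dn; case: ifP => [dC|_].
  apply: le_trans dC; rewrite ler_nat sum1_card; apply: card_hermite_family => i.
  rewrite lt0n; apply: contraTneq n0 => di; rewrite -dn (bigD1 i) //= di.
  by rewrite mul0n.
exact: C0.
Qed.

(** * From weight bounds to the abscissa *)

(** For [s > e + 1], the series is dominated by a sum over all diagonals of the product of the
    [d_i ^ (e - s)]. This factors as the [h]-th power of a convergent one-variable sum. *)
Lemma abscissa_le (R : realType) (h : nat) (P : set (lat h) -> Prop)
    (U : 'M[int]_h) (M e : R) :
  U \in unitmx -> 0 <= M -> (forall H, P H -> is_addsubgroup H) ->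
  (forall H n d A, P H -> has_index H n ->
    hermite_form h [set w | H (w *m U)] d A -> (\prod_i d i)%N = n ->
    (\prod_(i < h) d i ^ (h - i.+1))%N%:R <= M * n%:R `^ e) ->
  (@abscissa R h P <= (e + 1)%:E)%E.
Proof.
move=> Uu M0 PH bound; apply/lee_addgt0Pr => eps eps0.
apply: ge_ereal_inf; exists (e + 1 + eps)%R%:E => //; exists (e + 1 + eps) => //=.
set s := e + 1 + eps; have se : 1 < s - e by rewrite /s; lra.
have [Z ZP] := zeta_partial_sum_bounded R (s - e) se.
apply: (@le_lt_trans _ _ (M * Z ^+ h)%:E); last exact: ltry.
have a_ge0 n : (0 <= @a_count R h P n)%E by exact: esum_ge0.
apply: lime_le.
  apply: is_cvg_nneseries => n _ _; exact: mule_ge0.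
apply: nearW => N.
pose T n := #|[pred d : {ffun 'I_h -> 'I_N} | \prod_i d i == n]%N|.
apply: (@le_trans _ _ (\sum_(1 <= n < N) (M * (n%:R `^ (e - s) * (T n)%:R))%:E)%E).
  rewrite !big_nat; apply: lee_sum => n nN.
  have -> : M * (n%:R `^ (e - s) * (T n)%:R) =
      (M * n%:R `^ e) * (T n)%:R * n%:R `^ (- s).
    rewrite powRD ?pnatr_eq0 -?lt0n; last by case/andP: nN => ->; rewrite implybT.
    ring.
  rewrite EFinM; apply: lee_wpmul2r; first by rewrite lee_fin powR_ge0.
  have C0 : 0 <= M * n%:R `^ e by rewrite mulr_ge0 // powR_ge0.
  apply: a_count_le Uu C0 PH nN _ => H d A PHH Hn hf dn; exact: bound hf dn.
rewrite sumEFin lee_fin -mulr_sumr; apply: ler_wpM2l => //.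
apply: (@le_trans _ _ ((\sum_(0 <= k < N) k%:R `^ (e - s)) ^+ h)); last first.
  rewrite -opprB; apply: lerXn2r; rewrite ?nnegrE ?ZP //.
    by apply: sumr_ge0 => k _; exact: powR_ge0.
  apply: le_trans (ZP 0%N); rewrite big_geq //.
rewrite big_mkord -[X in _ <= _ ^+ X]card_ord -prodr_const bigA_distr_bigA /=.
have TE n : n%:R `^ (e - s) * (T n)%:R =
    \sum_(d : {ffun 'I_h -> 'I_N} | (\prod_i d i == n)%N)
      \prod_i (d i)%:R `^ (e - s).
  rewrite /T -sum1_card natr_sum mulr_sumr; apply: eq_big => d.
    by rewrite inE.
  by rewrite inE => /eqP <-; rewrite mulr1 natr_prod_powR.
under eq_bigr do rewrite TE.
(* Each diagonal is met for at most one [n], namely its product, and not at all if that product is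
   out of range. *)
rewrite (exchange_big_dep xpredT) //=; apply: ler_sum => d _.
rewrite big_const_seq iter_addr_0 (eq_count (a2 := pred1 (\prod_i d i)%N)).
  rewrite count_uniq_mem ?iota_uniq //.
  case: (_ \in _); rewrite ?mulr1n ?mulr0n //.
  by apply: prodr_ge0 => i _; exact: powR_ge0.
by move=> k /=; rewrite eq_sym.
Qed.

(** * Estimates for the number of forms with a given diagonal *)

Lemma prod_expn (I : finType) (d : I -> nat) (k : nat) :
  (\prod_i d i ^ k = (\prod_i d i) ^ k)%N.
Proof.
by rewrite (big_morph (expn^~ k) (fun m n => expnMn m n k) (exp1n k)).
Qed.

(** Only [d 0] has an exponent, [g + 1], exceeding [g]; its extra factor is split off. *)
Lemma hermite_weight_le (g : nat) (d : 'I_g.+2 -> nat) :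
  (forall i, (0 < d i)%N) ->
  (\prod_(i < g.+2) d i ^ (g.+2 - i.+1) <= d 0%R * (\prod_i d i) ^ g)%N.
Proof.
move=> d0; rewrite -prod_expn (bigD1 0) //= [X in (_ <= _ * X)%N](bigD1 0) //=.
rewrite subn1 expnS -mulnA !leq_mul //.
apply: leq_prod => i; rewrite -val_eqE /= => i0.
by rewrite leq_pexp2l //; lia.
Qed.

(** The entries with [i >= 2] have exponent at most [g - 1], so they absorb the product that bounds
    the extra factor [d 0]. *)
Lemma hermite_weight_le2 (g m : nat) (d : 'I_g.+2 -> nat) :
  (forall i, (0 < d i)%N) ->
  (d 0%R <= m * \prod_(i < g.+2 | 2 <= i) d i)%N ->
  (\prod_(i < g.+2) d i ^ (g.+2 - i.+1) <= m * (\prod_i d i) ^ g)%N.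
Proof.
move=> d0 dm; rewrite -prod_expn !prod_ord_ge2 /= subn1 subn2 expnS /=.
have le2 : (\prod_(i < g.+2 | 2 <= i) d i *
    \prod_(i < g.+2 | 2 <= i) d i ^ (g.+2 - i.+1) <=
    \prod_(i < g.+2 | 2 <= i) d i ^ g)%N.
  rewrite -big_split; apply: leq_prod => i i2 /=.
  by rewrite -expnS leq_pexp2l //; have := ltn_ord i; lia.
apply: leq_trans (leq_mul (leqnn m) (leq_mul (leqnn _) (leq_mul (leqnn _) le2))).
apply: leq_trans (leq_mul (leq_mul dm (leqnn _)) (leqnn _)) _.
by rewrite leq_eqVlt; apply/orP; left; apply/eqP; ring.
Qed.

(** * Abscissa bounds for subrings and ideals *)

Lemma abscissa_subring_le (R : realType) (g c : nat)
    (br : lat g.+2 -> lat g.+2 -> lat g.+2) :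
  is_lie_bracket br -> (exists x y, br x y <> 0) -> nilpotency_class br c ->
  (@abscissa R g.+2 (is_subring br) <= (g.+2%:R - 2^-1)%:E)%E.
Proof.
move=> Hb Hn Hc; have [U [x [a [b [Uu zc a0 bE]]]]] := adapted_frame g c br Hb Hn Hc.
have -> : g.+2%:R - 2^-1 = 2^-1 + g%:R + 1 :> R by rewrite -addn2 natrD; lra.
apply: (@abscissa_le R _ _ U `|a|%N%:R) => // [H []//|H n d A HH _ hf dn].
have [d0 _ _ _] := hf.
have le0 := subring_diag _ br U x a b H d A Hb Uu zc a0 bE HH hf.
have m1 : (1 <= `|a|)%N by rewrite absz_gt0.
(* With [n = d_0 X] and [d_0 <= |a| X], one gets [d_0 ^ 2 <= |a| n]; weakening [|a|] to its square
   makes the root exactly [|a| sqrt n]. *)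
have sq : (d 0%R ^ 2 <= `|a| ^ 2 * n)%N.
  rewrite -dn prod_ord_ge2 -!mulnn; move: (_ * \prod_(i < _ | _) _)%N le0 => X le0.
  apply: leq_trans (leq_mul (leqnn _) le0) _; rewrite mulnCA.
  by rewrite leq_mul // leq_pmulr.
have d_le : (d 0)%:R <= `|a|%N%:R * n%:R `^ 2^-1 :> R.
  rewrite powR12_sqrt // -(@ler_pXn2r _ 2) ?nnegrE ?mulr_ge0 ?sqrtr_ge0 //.
  by rewrite exprMn sqr_sqrtr // -!natrX -natrM ler_nat.
have nn0 : n%:R != 0 :> R by rewrite pnatr_eq0 -lt0n -dn prodn_gt0.
apply: (@le_trans _ _ (d 0%R * n ^ g)%N%:R).
  by rewrite ler_nat -dn hermite_weight_le.
rewrite powRD ?nn0 ?implybT // powR_mulrn // mulrA natrM natrX.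
by rewrite ler_wpM2r // exprn_ge0.
Qed.

Lemma abscissa_ideal_le (R : realType) (g c : nat)
    (br : lat g.+2 -> lat g.+2 -> lat g.+2) :
  is_lie_bracket br -> (exists x y, br x y <> 0) -> nilpotency_class br c ->
  (@abscissa R g.+2 (is_ideal br) <= (g.+2%:R - 1)%:E)%E.
Proof.
move=> Hb Hn Hc; have [U [x [a [b [Uu zc a0 bE]]]]] := adapted_frame g c br Hb Hn Hc.
have -> : g.+2%:R - 1 = g%:R + 1 :> R by rewrite -addn2 natrD; lra.
apply: (@abscissa_le R _ _ U `|a|%N%:R) => // [H []//|H n d A HH _ hf dn].
have [d0 _ _ _] := hf.
have le0 := ideal_diag _ br U x a b H d A Hb Uu zc a0 bE HH hf.
rewrite powR_mulrn // -natrX -natrM ler_nat -dn; exact: hermite_weight_le2.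
Qed.

Lemma nonabelian_rank_ge2 (h : nat) (br : lat h -> lat h -> lat h) :
  is_lie_bracket br -> (exists x y, br x y <> 0) -> (1 < h)%N.
Proof.
case: h br => [|[|h]] br Hb [x [y xy]] //; case: xy.
  by apply/rowP => -[].
exact: bracket_rank1.
Qed.

Theorem theorem4p3 (R : realType) (h c : nat)
  (br : lat h -> lat h -> lat h)
  (Hlie : is_lie_bracket br)
  (Hnonab : exists x y, br x y <> 0)
  (Hclass : nilpotency_class br c) :
  [/\ (c = 2%N -> (@abscissa R h (is_subring br) <= (h%:R - 2^-1)%:E)%E),
      ((2 < c)%N -> (@abscissa R h (is_subring br) <= (h%:R - (c.-1%:R)^-1)%:E)%E) &
      (@abscissa R h (is_ideal br) <= (h%:R - 1)%:E)%E].
Proof.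
have h2 := nonabelian_rank_ge2 h br Hlie Hnonab.
case: h br Hlie Hnonab Hclass h2 => [|[|g]] // br Hlie Hnonab Hclass _.
have sub := abscissa_subring_le R g c br Hlie Hnonab Hclass.
split=> // [c2|]; last exact: (abscissa_ideal_le R g c br Hlie Hnonab Hclass).
apply: le_trans sub _; rewrite lee_fin lerD2l lerN2 lef_pV2 ?posrE ?ltr0n ?ler_nat.
- by case: c c2 {Hclass} => [|[|[]]].
- by case: c c2 {Hclass} => [|[|[]]].
- by [].
Qed.
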